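(* For all integers $i,j,n\ge 0$, \[ \Phi_{i,j}(n)=[q^{i}x^{j}z^{n}]\,F(q,x,1,z), \] where $\Phi_{i,j}(n)$ is the number of permutations of $\{1,\dots,n+1\}$ having exactly $i$ cyclic occurrences of the pattern 2--13 and exactly $j+1$ cycles, and $F$ is the continued fraction defined in the context. That is, $F(q,x,1,z)$ is the ordinary generating function of the numbers $\Phi_{i,j}(n)$.
   Context: **The continued fraction.** $F(q,x,y,t)$ is the formal power series in $t$ (with coefficients polynomials in $q,x,y$) given by \[ F(q,x,y,t)=\cfrac{1}{1-t([1]^x_q+[1]^y_q)-\cfrac{t^2[1]_q[2]^{x,y}_q}{1-t([2]^x_q+[2]^y_q)-\cfrac{t^2[2]_q[3]^{x,y}_q}{1-t([3]^x_q+[3]^y_q)-\cdots}}} \] where for $h\ge1$: $[h]_q=1+q+\dots+q^{h-1}$; $[h]^x_q=1+q+\dots+q^{h-2}+xq^{h-1}$; $[h]^y_q=1+q+\dots+q^{h-2}+yq^{h-1}$ (so $[1]^x_q=x$, $[1]^y_q=y$); and for $h\ge 2$, $[h]^{x,y}_q=1+q+\dots+q^{h-3}+(x+y-xy)q^{h-2}+xy\,q^{h-1}$ (so $[2]^{x,y}_q=(x+y-xy)+xyq$). **Standard cycle form.** For a permutation $\pi$ of $[N]=\{1,\dots,N\}$, its standard cycle form $C(\pi)=(c^1_1\cdots c^1_{i_1})\cdots(c^k_1\cdots c^k_{i_k})$ is its disjoint cycle decomposition (fixed points included as cycles of length 1), where a cycle $(c_1c_2\cdots c_m)$ means $c_1\mapsto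 c_2\mapsto\cdots\mapsto c_m\mapsto c_1$, each cycle is written starting with its smallest element, and the cycles are listed from left to right in decreasing order of their smallest elements. **Cyclic occurrences of 2--13.** A cyclic occurrence of 2--13 in $\pi$ is either - an occurrence between cycles: cycle indices $a<b$, an element $u=c^a_s$ of cycle $a$, and two consecutive entries $v=c^b_t$, $w=c^b_{t+1}$ ($1\le t<i_b$) of cycle $b$, with $v<u<w$; or - an occurrence within a cycle: a cycle index $a$ and positions $s<t$ with $t+1\le i_a$ such that $c^a_t<c^a_s<c^a_{t+1}$. The number of cyclic occurrences is the total number of occurrences of both kinds. *)

(* Defs.v *)
From mathcomp Require Import all_boot all_order all_algebra perm.

Set Implicit Arguments.
Unset Strict Implicit.
Unset Printing Implicit Defensive.

Import GRing.Theory.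
Local Open Scope ring_scope.

(* The series \sum_n A_n t^n over R is represented by n |-> A_n. *)
Definition series (R : Type) := nat -> R.

Section Series.
Variable R : comNzRingType.
Implicit Types (A B w : series R) (n k : nat).

Definition mul_series A B : series R :=
  fun n => \sum_(k < n.+1) A k * B (n - k)%N.

Definition one_series : series R := fun n => (n == 0%N)%:R.

Definition exp_series w k : series R := iter k (mul_series w) one_series.

(* 1 / (1 - w) = 1 + w + w^2 + ... for a series w without constant term: then
   w^k starts in degree k, so only the powers k <= n contribute to t^n. *)
Definition inv_1B w : series R := fun n => \sum_(k < n.+1) exp_series w k n.

Let trunc N A : {poly R} := \poly_(i < N) A i.

Let coef_trunc_mul N A (p : {poly R}) n :
  (n < N)%N -> (trunc N A * p)`_n = \sum_(k < n.+1) A k * p`_(n - k).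
Proof.
move=> ltnN; rewrite coefM; apply: eq_bigr => k _.
by rewrite coef_poly (leq_ltn_trans _ ltnN) // -ltnS.
Qed.

Let exp_seriesE N w k n :
  (n < N)%N -> exp_series w k n = (trunc N w ^+ k)`_n.
Proof.
elim: k n => [|k IHk] n ltnN; first by rewrite expr0 coef1.
rewrite exprS coef_trunc_mul //; apply: eq_bigr => j _.
by rewrite -IHk // (leq_ltn_trans (leq_subr _ _)).
Qed.

Let coef_exp0 (p : {poly R}) k n : p`_0 = 0 -> (n < k)%N -> (p ^+ k)`_n = 0.
Proof.
move=> p0; elim: k n => // k IHk n; rewrite ltnS => lenk.
rewrite exprS coefM big1 // => -[[|i] /= lti] _; first by rewrite p0 mul0r.
by rewrite IHk ?mulr0 //; apply: leq_trans lenk; rewrite ltn_subrL; case: (n) lti.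
Qed.

Lemma inv_1BE w n : w 0%N = 0 ->
  inv_1B w n = one_series n + mul_series w (inv_1B w) n.
Proof.
move=> w0; set p := trunc n.+1 w.
have p0 : p`_0 = 0 by rewrite coef_poly w0.
have invE m : (m <= n)%N -> inv_1B w m = (\sum_(k < n.+1) p ^+ k)`_m.
  move=> lemn; rewrite coef_sum /inv_1B.
  under eq_bigr => k _ do rewrite (@exp_seriesE n.+1) ?ltnS //.
  rewrite (big_ord_widen n.+1 (fun k => (p ^+ k)`_m)) // big_mkcond /=.
  by apply: eq_bigr => k _; case: ltnP => // ltmk; rewrite coef_exp0.
have -> : mul_series w (inv_1B w) n = (p * \sum_(k < n.+1) p ^+ k)`_n.
  rewrite coef_trunc_mul //; apply: eq_bigr => k _.
  by rewrite invE ?leq_subr.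
rewrite invE // mulr_sumr.
have -> : \sum_(k < n.+1) p * p ^+ k = \sum_(k < n.+1) p ^+ k.+1.
  by apply: eq_bigr => k _; rewrite exprS.
rewrite big_ord_recl expr0 coefD coef1 /one_series; congr (_ + _).
by rewrite big_ord_recr /= coefD [(p ^+ n.+1)`_n]coef_exp0 ?addr0.
Qed.

Lemma eq_inv_1B w w' n :
    (forall m, (m <= n)%N -> w m = w' m) -> inv_1B w n = inv_1B w' n.
Proof.
move=> eqw; apply: eq_bigr => k _; rewrite !(@exp_seriesE n.+1) //.
suff -> : trunc n.+1 w = trunc n.+1 w' by [].
by apply/polyP=> i; rewrite !coef_poly ltnS; case: leqP => // /eqw.
Qed.

End Series.

Section ContinuedFraction.
Variables (R : comNzRingType) (q x y : R).
Implicit Types h d n : nat.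

(* qint h = [h]_q, qint1 x h = [h]^x_q and qint1 y h = [h]^y_q for h >= 1, and
   qint2 h = [h]^{x,y}_q for h >= 2; smaller h never occur in the fraction. *)
Definition qint h : R := \sum_(k < h) q ^+ k.

Definition qint1 (z : R) h : R := \sum_(k < h.-1) q ^+ k + z * q ^+ h.-1.

Definition qint2 h : R :=
  \sum_(k < h - 2) q ^+ k + (x + y - x * y) * q ^+ (h - 2)
    + x * y * q ^+ h.-1.

(* t * b + t^2 * c * A *)
Definition level (b c : R) (A : series R) : series R :=
  fun n => match n with 0 => 0 | 1 => b | m.+2 => c * A m end.

(* The part of the continued fraction starting with the denominator
   1 - t ([h]^x_q + [h]^y_q) - ..., cut off (i.e. replaced by 0) after d
   denominators. *)
Fixpoint convergent d h : series R :=
  if d is d'.+1 then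
    inv_1B (level (qint1 x h + qint1 y h) (qint h * qint2 h.+1)
                  (convergent d' h.+1))
  else fun=> 0.

(* The coefficient of t^n is the same in all convergents with more than n
   denominators, by convergent_stable; cfracE is the defining recursion of the
   infinite fraction. *)
Definition cfrac_from h : series R := fun n => convergent n.+1 h n.

Definition cfrac : series R := cfrac_from 1.

Lemma convergent_stable d h n :
  (n < d)%N -> convergent d h n = cfrac_from h n.
Proof.
rewrite /cfrac_from => ltnd.
suff stable e e' m k : (m < e)%N -> (m < e')%N ->
    convergent e k m = convergent e' k m.
  by apply: stable; rewrite ?ltnS.
elim: e e' m k => // e IHe [|e'] // m k ltme ltme' /=.
apply: eq_inv_1B => -[|[|i]] //= leim; congr (_ * _).
by apply: IHe; apply: (leq_trans (ltnW leim)).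
Qed.

Lemma cfracE h n :
  cfrac_from h n = one_series R n +
    mul_series (level (qint1 x h + qint1 y h) (qint h * qint2 h.+1)
                      (cfrac_from h.+1)) (cfrac_from h) n.
Proof.
set w := level _ _ _.
suff fromE m : cfrac_from h m = inv_1B w m.
  rewrite fromE inv_1BE //; congr (_ + _).
  by apply: eq_bigr => k _; rewrite fromE.
rewrite /cfrac_from /=; apply: eq_inv_1B => -[|[|i]] //= lim.
by rewrite convergent_stable // ltnW.
Qed.

End ContinuedFraction.

(* F(q,x,y,t), with coefficients in Z[q][x][y]: y is the outermost variable. *)
Definition F : series {poly {poly {poly int}}} :=
  cfrac ('X%:P%:P) ('X%:P) 'X.

Section Permutations.
Local Open Scope nat_scope.
Variable N : nat.
Implicit Type s : {perm 'I_N}.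

(* Standard cycle form: each cycle (c, s c, s (s c), ...) starts with its
   minimum c, and the cycles are listed by decreasing minima. The underlying set
   is {0,...,N-1} instead of {1,...,N}, as only the relative order of the
   entries matters below. *)
Definition cycle_minima s : seq 'I_N :=
  [seq c <- rev (enum 'I_N) | [forall d in porbit s c, c <= d]].

Definition cycle_form s : seq (seq nat) :=
  [seq [seq val d | d <- traject s c #|porbit s c|] | c <- cycle_minima s].

End Permutations.

Section Pattern.
Local Open Scope nat_scope.

Definition entry (C : seq (seq nat)) a p : nat := nth 0 (nth [::] C a) p.

Definition len (C : seq (seq nat)) a : nat := size (nth [::] C a).

(* Occurrences of 2--13 are counted as tuples of positions. *)
Definition occ_between (C : seq (seq nat)) : nat :=
  \sum_(b < size C) \sum_(a < b) \sum_(p < len C a) \sum_(t < (len C b).-1)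
     (entry C b t < entry C a p < entry C b t.+1).

Definition occ_within (C : seq (seq nat)) : nat :=
  \sum_(a < size C) \sum_(t < (len C a).-1) \sum_(p < t)
     (entry C a t < entry C a p < entry C a t.+1).

Definition cyclic_occ N (s : {perm 'I_N}) : nat :=
  occ_between (cycle_form s) + occ_within (cycle_form s).

Definition Phi i j n : nat :=
  #|[set s : {perm 'I_n.+1} | (cyclic_occ s == i) && (#|porbits s| == j.+1)]|.

End Pattern.

(* Main.v *)
Require Import Defs.
From mathcomp Require Import all_boot all_order all_algebra perm.
From mathcomp Require Import ring zify.

(** Writing the standard cycle form of a permutation [s] without its
    parentheses gives a word (Foata's transformation). Every cycle starts
    with a letter smaller than all letters before it, and contains no other
    such letter, so the cycles can be read off the word: their number is the
    number of left-to-right minima, and [s |-> foata_word s] is a bijection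
    onto the permutations of 0, ..., N-1. An ascent of the word never
    straddles two cycles, so the cyclic occurrences of 2--13 are the
    occurrences of the ordinary pattern 2--13 in the word ([cyclic_occE],
    [card_porbitsE], [perm_foata_words]).

    The words are enumerated by inserting the letters 0, 1, 2, ... in turn.
    The letters smaller than [u] cut a word into blocks, which are separated
    by holes that larger letters will fill later. When [u] is put into a
    hole, the ascents [v < u < w] to its right are the holes to its right,
    because a hole sits between a letter smaller than [u] and a letter
    larger than [u]; and [u] is a left-to-right minimum exactly if it goes
    in front of all blocks. Both statistics thus depend only on the place of
    [u] among the holes, and the total weight of all completions of a
    partial word depends only on its number [k] of holes. It satisfies the
    recurrence [completions], by [sum_insertions]. That every word is
    reached, and only once, follows from the reversibility of insertion and
    from a count: at [q = x = 1] the recurrence yields [N!] words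
    ([completions11]).

    This recurrence describes weighted Motzkin paths, but not quite those
    of the continued fraction [F(q, x, 1, t)]: the two belong to the two
    contractions of the Stieltjes fraction with coefficients [[1]^x, [1],
    [2]^x, [2], ...]. Adding consecutive values of [completions] passes from
    one contraction to the other ([pathsE]), and costs the factor [x] and
    the shift from [n + 1] to [n] ([completions_cfrac]). *)

Set Implicit Arguments.
Unset Strict Implicit.
Unset Printing Implicit Defensive.
Import GRing.Theory.
Local Open Scope ring_scope.

(** * Words, partial words and insertion *)

Lemma uniq_flatten_map (S T : eqType) (f : S -> seq T) (r : seq S) :
  uniq r -> {in r, forall a, uniq (f a)} ->
  {in r &, forall a b z, z \in f a -> z \in f b -> a = b} ->
  uniq (flatten [seq f a | a <- r]).
Proof.
elim: r => //= a r IHr /andP[a_r uniq_r] uniq_f inj_f.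
rewrite cat_uniq uniq_f ?inE ?eqxx //= IHr ?andbT //; first last.
- by move=> b c br cr z; apply: inj_f; rewrite inE ?br ?cr orbT.
- by move=> b br; apply: uniq_f; rewrite inE br orbT.
apply/hasPn=> z /flattenP[_ /mapP[b br ->] zb]; apply: contra a_r => za.
by rewrite (inj_f a b _ _ z) // inE ?eqxx ?br ?orbT.
Qed.

Section Words.
Local Open Scope nat_scope.

(** The last letter is treated as if 0 followed it, so that it starts no
    ascent. *)
Fixpoint straddles (a : nat) (w : seq nat) : nat :=
  if w is v :: w' then (v < a < head 0 w') + straddles a w' else 0.

Fixpoint occ213 (w : seq nat) : nat :=
  if w is u :: w' then straddles u w' + occ213 w' else 0.

(** Only the left-to-right minima smaller than [m] count: [m] stands for the
    minimum of the letters that precede [w]. *)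
Fixpoint lrmin (m : nat) (w : seq nat) : nat :=
  if w is v :: w' then (v < m) + lrmin (minn m v) w' else 0.

(** The flag of a letter tells whether a hole follows it, which has to
    receive at least one larger letter. The place in front of all letters is
    always open, but may stay empty; it has no flag and is not counted by
    [holes]. *)
Definition partial_word := seq (nat * bool).

Implicit Types (s t : partial_word) (a m u v : nat) (f : bool).

Definition letters s := unzip1 s.

Definition holes s : nat := count snd s.

(** A hole counts as a letter larger than [a], since it will only receive
    letters larger than those already present. *)
Fixpoint partial_straddles a s : nat :=
  if s is (v, f) :: s' then
    ((v < a) && (f || (a < head 0 (letters s')))) + partial_straddles a s'
  else 0.

Fixpoint partial_occ s : nat :=
  if s is (v, f) :: s' then partial_straddles v s' + partial_occ s' else 0.

Lemma partial_occ_complete s :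
  holes s = 0 -> partial_occ s = occ213 (letters s).
Proof.
suff pstrE a s' :
    holes s' = 0 -> partial_straddles a s' = straddles a (letters s').
  elim: s => [|[v []] s IHs] //= s0; by rewrite pstrE ?IHs.
elim: s' => [|[v []] s' IHs] //= s0; by rewrite IHs.
Qed.

(** In the hole between two blocks, [u] can be separated from both, be glued
    to the left one or to the right one, or close the hole. *)
Fixpoint fillings u s : seq partial_word :=
  if s is (v, f) :: s' then
    [seq (v, f) :: t | t <- fillings u s'] ++
    (if f then [:: (v, true) :: (u, true) :: s';
                   (v, true) :: (u, false) :: s';
                   (v, false) :: (u, true) :: s';
                   (v, false) :: (u, false) :: s']
     else [::])
  else [::].

Definition insertions u s : seq partial_word :=
  [:: (u, true) :: s, (u, false) :: s & fillings u s].

Fixpoint partial_words u : seq partial_word :=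
  if u is u'.+1 then flatten [seq insertions u' s | s <- partial_words u']
  else [:: [::]].

(** Undoes the insertion of [u]: the place of [u] becomes a hole, also when
    [u] was glued to its left neighbour. *)
Fixpoint erase u t : partial_word :=
  if t is (v, f) :: t' then
    if v == u then t'
    else (v, f || (ohead (letters t') == Some u)) :: erase u t'
  else [::].

Lemma head_fillings u s t :
  t \in fillings u s -> head 0 (letters t) = head 0 (letters s) /\
  ohead (letters t) = ohead (letters s).
Proof.
case: s => [|[v f] s] //=; rewrite mem_cat => /orP[/mapP[t' _ ->] //|].
by case: f => //; rewrite !inE => /or4P[] /eqP->.
Qed.

Lemma perm_swap2 (T : eqType) (a b : T) l : perm_eq (a :: b :: l) (b :: a :: l).
Proof. by apply/seq.permP=> p /=; rewrite addnCA. Qed.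

Lemma perm_fillings u s t :
  t \in fillings u s -> perm_eq (letters t) (u :: letters s).
Proof.
elim: s t => [|[v f] s IHs] t //=; rewrite mem_cat => /orP[/mapP[t' ins_t ->]|].
  by rewrite /= -(permPr (perm_swap2 v u _)) perm_cons IHs.
by case: f => //; rewrite !inE => /or4P[] /eqP-> /=; apply: perm_swap2.
Qed.

Lemma perm_insertions u s t :
  t \in insertions u s -> perm_eq (letters t) (u :: letters s).
Proof. by rewrite !inE => /or3P[/eqP->|/eqP->|/perm_fillings]. Qed.

Lemma perm_partial_words u s :
  s \in partial_words u -> perm_eq (letters s) (iota 0 u).
Proof.
elim: u s => [|u IHu] s; first by rewrite inE => /eqP->.
rewrite -addn1 iotaD cats1 addn1 => /flattenP[] _ /mapP[s' s'P ->].
move/perm_insertions/perm_trans=> -> //.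
by rewrite perm_sym perm_rcons perm_cons perm_sym IHu.
Qed.

Lemma partial_words_lt u s : s \in partial_words u -> all (gtn u) (letters s).
Proof.
move/perm_partial_words=> /perm_all->; apply/allP=> v; by rewrite mem_iota.
Qed.

Lemma erase_fillings u s t :
  u \notin letters s -> t \in fillings u s -> erase u t = s.
Proof.
elim: s t => [|[v f] s IHs] t //=.
rewrite inE negb_or => /andP[neq_uv us]; have neq_vu : (v == u) = false.
  by rewrite eq_sym (negPf neq_uv).
rewrite mem_cat => /orP[/mapP[t' ins_t ->]|].
  rewrite /= neq_vu (IHs t') // (head_fillings ins_t).2.
  suff -> : (ohead (letters s) == Some u) = false by rewrite orbF.
  case: (s) us => [|[w g] s'] //=; rewrite inE negb_or => /andP[neq_uw _].
  by apply/eqP=> -[E]; rewrite E eqxx in neq_uw.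
case: f => //; rewrite !inE => /or4P[] /eqP-> /=;
  by rewrite neq_vu !eqxx ?orbT.
Qed.

Lemma erase_insertions u s t :
  u \notin letters s -> t \in insertions u s -> erase u t = s.
Proof.
move=> us; rewrite !inE => /or3P[/eqP->|/eqP->|/erase_fillings->] //=;
  by rewrite eqxx.
Qed.

Lemma front_notin_fillings u f s s' :
  u \notin letters s -> (u, f) :: s' \notin fillings u s.
Proof.
move=> us; apply/negP => /head_fillings[_] /=.
by case: s us => [|[v g] s] //=; rewrite inE negb_or => /andP[/eqP neq _] [].
Qed.

Lemma uniq_fillings u s : u \notin letters s -> uniq (fillings u s).
Proof.
elim: s => [|[v f] s IHs] //=; rewrite inE negb_or => /andP[_ us].
rewrite cat_uniq map_inj_uniq ?IHs //=; last by move=> ? ? [].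
case: f => //=; rewrite !orbF !negb_or.
have nP f g :
    (v, f) :: (u, g) :: s \notin [seq (v, true) :: t | t <- fillings u s].
  apply/negP=> /mapP[t + []]; move=> + _ E; rewrite -E.
  by apply/negP; apply: front_notin_fillings.
rewrite !nP /=.
by rewrite !eqseq_cons !xpair_eqE !eqxx.
Qed.

Lemma uniq_insertions u s : u \notin letters s -> uniq (insertions u s).
Proof.
move=> us /=; rewrite inE negb_or !front_notin_fillings // uniq_fillings //.
by rewrite eqseq_cons xpair_eqE !eqxx.
Qed.

Lemma notin_partial_words u s : s \in partial_words u -> u \notin letters s.
Proof.
by move/partial_words_lt=> /allP su; apply/negP=> /su; rewrite /= ltnn.
Qed.

(** Partial words obtained from different ones differ, as [erase] recovers
    the original. *)
Lemma uniq_partial_words u : uniq (partial_words u).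
Proof.
elim: u => // u IHu.
apply: uniq_flatten_map IHu _ _ => [s sP|s s' sP s'P t ts ts'].
  exact: uniq_insertions (notin_partial_words sP).
rewrite -(erase_insertions (notin_partial_words sP) ts).
by rewrite (erase_insertions (notin_partial_words s'P) ts').
Qed.

Lemma lrmin_gt u m w : all (gtn u) w -> u <= m -> lrmin m w = lrmin u w.
Proof.
case: w => //= v w /andP[lt_vu _] le_um.
rewrite lt_vu (leq_trans lt_vu le_um) !(minn_idPr _) // ltnW //.
exact: leq_trans lt_vu le_um.
Qed.

(** A letter put into a hole behind a smaller letter is no left-to-right
    minimum, and does not change which letters are. *)
Lemma lrmin_fillings u s t m :
  all (gtn u) (letters s) -> t \in fillings u s ->
  lrmin m (letters t) = lrmin m (letters s).
Proof.
elim: s t m => [|[v f] s IHs] t m //= /andP[lt_vu su].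
rewrite mem_cat => /orP[/mapP[t' ins_t ->]|] /=; first by rewrite (IHs t').
by case: f => //; rewrite !inE => /or4P[] /eqP-> /=;
  rewrite (minn_idPl (_ : minn m v <= u)) ?geq_min ?(ltnW lt_vu) ?orbT //
    [u < _]ltnNge geq_min (ltnW lt_vu) orbT.
Qed.

(** A letter larger than all others is straddled by no ascent between
    letters, but by every hole. *)
Lemma partial_straddles_max u s :
  all (gtn u) (letters s) -> partial_straddles u s = holes s.
Proof.
elim: s => [|[v f] s IHs] //= /andP[lt_vu su]; rewrite IHs // lt_vu /=.
suff /negPf-> : ~~ (u < head 0 (letters s)) by rewrite orbF.
by case: s su {IHs} => [|[w g] s] //= /andP[/ltnW]; rewrite -leqNgt.
Qed.

(** For [a < u], the hole or the letter [u] next to a given letter plays the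
    role of the original hole, and a pair that starts with [u] straddles
    nothing. *)
Lemma partial_straddles_fillings a u s t :
  a < u -> t \in fillings u s -> partial_straddles a t = partial_straddles a s.
Proof.
move=> lt_au; elim: s t => [|[v f] s IHs] t //=; rewrite mem_cat.
case/orP=> [/mapP[t' ins_t ->] /=|].
  by rewrite (IHs t') // (head_fillings ins_t).1.
have nua : (u < a) = false by rewrite ltnNge ltnW.
by case: f => //; rewrite !inE => /or4P[] /eqP-> /=; rewrite ?lt_au nua.
Qed.

End Words.

(** * Weighted enumeration of words *)

Section Weights.
Variables (R : comNzRingType) (q x : R).

(** The new letter [u] creates one occurrence of 2--13 for each hole to its
    right, so the choice of the hole contributes [[k]] if there are [k]
    holes. The four ways to use the hole then leave [k + 1], [k], [k] or
    [k - 1] holes. *)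
Lemma sum_fillings u (s : partial_word) (G : nat -> R) :
  all (gtn u) (letters s) ->
  \sum_(t <- fillings u s) q ^+ partial_occ t * G (holes t) =
    q ^+ partial_occ s * qint q (holes s) *
      (G (holes s).+1 + G (holes s) *+ 2 + G (holes s).-1).
Proof.
elim: s G => [|[v f] s IHs] G /=.
  by rewrite big_nil /qint big_ord0 mulr0 mul0r.
case/andP=> lt_vu su; rewrite big_cat big_map /=.
have -> : \sum_(t <- fillings u s)
    q ^+ (partial_straddles v t + partial_occ t) * G (f + holes t)%N =
    q ^+ partial_straddles v s *
      \sum_(t <- fillings u s) q ^+ partial_occ t * G (f + holes t)%N.
  rewrite mulr_sumr; apply: eq_big_seq => t tP.
  by rewrite (partial_straddles_fillings lt_vu tP) exprD mulrA.
rewrite (IHs (fun k => G (f + k)%N)) //.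
case: f => /=; last first.
  by rewrite big_nil addr0 !add0n exprD !mulrA.
have nuv : (u < v)%N = false by rewrite ltnNge ltnW.
rewrite !big_cons big_nil /= nuv (partial_straddles_max su) ?add0n ?add1n /=.
have -> : qint q (holes s).+1 = qint q (holes s) + q ^+ holes s.
  by rewrite /qint big_ord_recr.
case: (posnP (holes s)) => [->|k0].
  by rewrite /qint big_ord0 !exprD expr0 /=; ring.
by rewrite ?add1n prednK // !exprD; ring.
Qed.

Definition weight N (s : partial_word) : R :=
  q ^+ partial_occ s * x ^+ lrmin N (letters s).

(** In front, [u] has all [k] holes to its right and is a left-to-right
    minimum, which contributes [x q^k]; this completes the factor [[k]] of a
    hole to [[k + 1]^x]. Gluing to the left is impossible there. *)
Lemma sum_insertions N u (s : partial_word) (G : nat -> R) :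
  (u < N)%N -> all (gtn u) (letters s) -> let k := holes s in
  \sum_(t <- insertions u s) weight N t * G (holes t) =
    weight N s * (qint1 q x k.+1 * (G k + G k.+1) + qint q k * (G k + G k.-1)).
Proof.
move=> ltuN su k; rewrite !big_cons /weight /= add0n add1n.
rewrite partial_straddles_max //.
rewrite ltuN (minn_idPr (ltnW ltuN)) -(lrmin_gt su (ltnW ltuN)) add1n exprS -/k.
under eq_big_seq => t tP.
  rewrite (lrmin_fillings _ su tP) mulrAC; over.
rewrite -mulr_suml sum_fillings // -/k /qint1 /= -/(qint q k) !exprD.
ring.
Qed.

(** The total weight of the ways to fill all [k] holes of a partial word by
    inserting [r] more letters, relative to the weight of that partial word. *)
Fixpoint completions r k : R :=
  if r is r'.+1 then
    qint1 q x k.+1 * (completions r' k + completions r' k.+1)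
      + qint q k * (completions r' k + completions r' k.-1)
  else (k == 0%N)%:R.

Lemma sum_partial_words N r u : (u + r <= N)%N ->
  \sum_(s <- partial_words u) weight N s * completions r (holes s) =
    completions (u + r) 0.
Proof.
elim: u r => [|u IHu] r leN.
  by rewrite /= big_seq1 /weight /= !expr0 !mul1r.
rewrite addSnnS -IHu ?addnS // big_flatten big_map; apply: eq_big_seq => s sP.
rewrite sum_insertions ?(partial_words_lt sP) //.
by rewrite (leq_trans _ leN) // addSn ltnS leq_addr.
Qed.

Lemma sum_complete_words N :
  \sum_(s <- partial_words N | holes s == 0%N) weight N s = completions N 0.
Proof.
rewrite -[N in RHS]addn0 -(@sum_partial_words N) ?addn0 // big_mkcond.
by apply: eq_bigr => s _ /=; case: eqP; rewrite ?mulr1 ?mulr0.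
Qed.
End Weights.

(** The [r] letters form a word, which is cut into a first part, possibly
    empty, and [k] nonempty parts that go into the holes: the [k] parts
    start at any [k] of the [r] letters. *)
Lemma completions11 r k : completions (1 : int) 1 r k = (r`! * 'C(r, k))%N%:R.
Proof.
elim: r k => [|r IHr] k; first by case: k.
have q1 h : qint (1 : int) h = h%:R.
  rewrite /qint; under eq_bigr do rewrite expr1n.
  by rewrite sumr_const card_ord.
rewrite /= !IHr /qint1 /= -/(qint (1 : int) k) !q1 mul1r expr1n.
rewrite -[_ + 1](natrD _ k 1) -!natrD -!natrM -natrD; congr (_%:R).
case: k => [|k]; first by rewrite !bin0 bin1 factS; lia.
rewrite [k.+1.-1]/= addn1 -!mulnDr [('C(r, k.+1) + 'C(r, k.+2))%N]addnC -!binS.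
rewrite mulnCA [(k.+1 * _)%N]mulnCA -!mulnDr mul_bin_left factS.
have [ltk|ltk] := ltnP k r.+1; first by rewrite -mulnDl subnK // mulnCA mulnA.
by rewrite bin_small // !muln0.
Qed.

Lemma letters_inj_complete (s t : partial_word) :
  holes s = 0%N -> holes t = 0%N -> letters s = letters t -> s = t.
Proof.
elim: s t => [|[v []] s IHs] [|[w []] t] //= s0 t0 [-> E]; by rewrite (IHs t).
Qed.

(** Insertion yields pairwise distinct words; it yields all of them because
    the weights at [q = x = 1] count [N!]. *)
Lemma complete_partial_words N :
  perm_eq [seq letters s | s <- partial_words N & holes s == 0%N]
          (permutations (iota 0 N)).
Proof.
set ws := [seq _ | _ <- _ & _].
have ws_uniq : uniq ws.
  rewrite map_inj_in_uniq ?filter_uniq ?uniq_partial_words // => s t.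
  rewrite !mem_filter => /andP[/eqP s0 _] /andP[/eqP t0 _].
  exact: letters_inj_complete.
have ws_sub : {subset ws <= permutations (iota 0 N)}.
  move=> _ /mapP[s + ->]; rewrite mem_filter mem_permutations => /andP[_].
  exact: perm_partial_words.
have ws_size : size ws = N`!.
  have := sum_complete_words (1 : int) 1 N; rewrite completions11 bin0 muln1.
  under eq_bigr do rewrite /weight !expr1n mul1r.
  rewrite big_const_seq iter_addr_0 => /eqP.
  by rewrite Num.Theory.eqr_nat size_map size_filter => /eqP.
apply: uniq_perm (permutations_uniq _) _ => //.
apply: (uniq_min_size ws_uniq ws_sub _).2.
by rewrite size_permutations ?iota_uniq // size_iota ws_size.
Qed.

Lemma sum_permutations (R : comNzRingType) (q x : R) N :
  \sum_(w <- permutations (iota 0 N)) q ^+ occ213 w * x ^+ lrmin N w =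
    completions q x N 0.
Proof.
rewrite -(perm_big _ (complete_partial_words N)) big_map big_filter.
rewrite -sum_complete_words.
by apply: eq_bigr => s /eqP s0; rewrite /weight partial_occ_complete.
Qed.

(** * The continued fraction *)

Section SeriesRing.
Variable R : comNzRingType.
Implicit Types (A B C : series R) (n : nat).

Lemma mul_seriesE N A B n : (n < N)%N ->
  mul_series A B n = (\poly_(i < N) A i * \poly_(i < N) B i)`_n.
Proof.
move=> ltnN; rewrite coefM; apply: eq_bigr => k _.
rewrite !coef_poly (leq_ltn_trans (leq_subr _ _) ltnN).
by rewrite (leq_ltn_trans _ ltnN) // -ltnS.
Qed.

Lemma mul_seriesC A B n : mul_series A B n = mul_series B A n.
Proof. by rewrite !(@mul_seriesE n.+1) // mulrC. Qed.

Lemma mul_seriesA A B C n :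
  mul_series A (mul_series B C) n = mul_series (mul_series A B) C n.
Proof.
pose p D := \poly_(i < n.+1) D i : {poly R}.
transitivity (p A * (p B * p C))`_n.
  rewrite coefM; apply: eq_bigr => k _; rewrite coef_poly ltn_ord.
  by rewrite -mul_seriesE // ltnS leq_subr.
rewrite mulrA coefM; apply: eq_bigr => k _.
by rewrite coef_poly ltnS leq_subr -mul_seriesE.
Qed.

Lemma mul_seriesS A B n :
  mul_series A B n.+1 = A 0%N * B n.+1 + mul_series (fun m => A m.+1) B n.
Proof. by rewrite /mul_series big_ord_recl subn0. Qed.

Lemma mul_seriesZl a A B n :
  mul_series (fun m => a * A m) B n = a * mul_series A B n.
Proof. by rewrite /mul_series mulr_sumr; under eq_bigr do rewrite -mulrA. Qed.

Lemma mul_seriesDl A B C n :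
  mul_series (fun m => A m + B m) C n = mul_series A C n + mul_series B C n.
Proof.
by rewrite /mul_series -big_split; apply: eq_bigr => k _; rewrite mulrDl.
Qed.

Lemma eq_mul_series A A' B B' n : A =1 A' -> B =1 B' ->
  mul_series A B n = mul_series A' B' n.
Proof. by move=> eqA eqB; apply: eq_bigr => k _; rewrite eqA eqB. Qed.
End SeriesRing.

Section Motzkin.
Variables (R : comNzRingType) (q x : R).

(* Consider Motzkin paths with weight [k+1]^x + [k+1] on a level step at
   height k, [k+2]^x on a step from k up to k + 1, and [k] on a step from k
   down to k - 1. Then A k enumerates the paths from height k to height k
   that do not go below k. *)
Let A k : series R := cfrac_from q x 1 k.+1.

(** Enumerates by length the Motzkin paths from height [k] down to height 0,
    which are cut at the first step from [k] to [k - 1]. *)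
Fixpoint paths k : series R :=
  if k is k'.+1 then
    fun n => if n is n'.+1 then qint q k * mul_series (A k) (paths k') n' else 0
  else A 0.

Lemma cfrac_from_0 k : A k 0 = 1.
Proof. by rewrite /A cfracE /mul_series big_ord1 mul0r addr0. Qed.

Lemma cfrac_from_S k n : A k n.+1 =
   (qint1 q x k.+1 + qint q k.+1) * A k n +
   (if n is n'.+1 then
      qint q k.+1 * qint1 q x k.+2 * mul_series (A k.+1) (A k) n'
    else 0).
Proof.
rewrite {1}/A cfracE add0r mul_seriesS mul0r add0r -/(A k).
have -> : qint1 q 1 k.+1 = qint q k.+1.
  by rewrite /qint1 /qint mul1r big_ord_recr.
have -> : qint2 q x 1 k.+2 = qint1 q x k.+2.
  rewrite /qint2 /qint1 subSS subSS subn0 !mulr1 (addrC x 1) addrK mul1r.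
  by rewrite /= [in RHS]big_ord_recr.
case: n => [|n]; first by rewrite /mul_series big_ord1 addr0.
by rewrite mul_seriesS mul_seriesZl.
Qed.

Lemma paths0 k : paths k 0 = (k == 0%N)%:R.
Proof. by case: k => //=; apply: cfrac_from_0. Qed.

(** The cases of the sum are those of the first step of a path: level, down
    and up. In the last case the rest of the path is cut at its first return
    to [k]: this is the term with [A (k + 1) * A k] in the recursion of the
    fraction. *)
Lemma pathsS k n : paths k n.+1 =
  (qint1 q x k.+1 + qint q k.+1) * paths k n + qint q k * paths k.-1 n
    + qint1 q x k.+2 * paths k.+1 n.
Proof.
case: k => [|k].
  rewrite /paths cfrac_from_S -/paths /qint big_ord0 mul0r addr0; congr (_ + _).
  by case: n => [|n]; rewrite ?mulr0 //= mulrA [qint1 _ _ _ * _]mulrC.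
rewrite [paths k.+1 n.+1]/=.
set d := qint q k.+1; set b := qint1 q x k.+2 + _.
case: n => [|n].
  by rewrite /= !mulr0 add0r addr0 /mul_series big_ord1 cfrac_from_0 mul1r.
rewrite mul_seriesS cfrac_from_0 mul1r.
pose rest : series R := fun m => if m is m'.+1 then
  qint q k.+2 * qint1 q x k.+3 * mul_series (A k.+2) (A k.+1) m' else 0.
rewrite (eq_mul_series (A' := fun m => b * A k.+1 m + rest m)
  (B' := paths k)) //; last by move=> m; rewrite cfrac_from_S.
rewrite mul_seriesDl mul_seriesZl.
rewrite mulrDr [d * paths k n.+1 + _]addrC mulrDr mulrCA -!addrA; congr (_ + _).
rewrite addrC; congr (_ + _).
rewrite [paths k.+2 n.+1]/=.
case: n => [|n]; first by rewrite /mul_series !big_ord1 mul0r /= !mulr0.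
rewrite mul_seriesS mul0r add0r mul_seriesZl -mul_seriesA.
rewrite [mul_series _ (paths k.+1) _]mul_seriesC mul_seriesS mul0r add0r.
rewrite mul_seriesZl -/paths [mul_series (A k.+2) _ _]mul_seriesC.
rewrite /d; ring.
Qed.

(** Grouping consecutive values of [completions] turns the recurrence with
    factors [[k+1]^x] on [(k, k + 1)] and [[k]] on [(k - 1, k)] into that of
    [paths]: with the operator of the recurrence factored into two
    bidiagonal ones, this exchanges the factors. *)
Lemma pathsE k n : paths k n = completions q x n k + completions q x n k.+1.
Proof.
elim: n k => [|n IHn] k; first by rewrite paths0 /= addr0.
rewrite pathsS !IHn /=; case: k => [|k]; last by rewrite [k.+1.-1]/=; ring.
by rewrite /qint big_ord0; ring.
Qed.

Lemma completions_cfrac n : completions q x n.+1 0 = x * cfrac q x 1 n.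
Proof.
rewrite -[cfrac _ _ _ n]/(paths 0 n) pathsE /= /qint1 big_ord0 expr0.
by rewrite /qint big_ord0 /=; ring.
Qed.
End Motzkin.

Section Morphism.
Variables (R S : comNzRingType) (f : {rmorphism R -> S}).

Lemma rmorph_inv_1B (w : series R) n : f (inv_1B w n) = inv_1B (f \o w) n.
Proof.
have expE k m : f (exp_series w k m) = exp_series (f \o w) k m.
  elim: k m => [|k IHk] m; first by rewrite /= /one_series rmorph_nat.
  rewrite [exp_series]lock /= -lock /= rmorph_sum.
  by apply: eq_bigr => i _; rewrite rmorphM -IHk.
by rewrite rmorph_sum; apply: eq_bigr => k _.
Qed.

Lemma rmorph_cfrac q x y n : f (cfrac q x y n) = cfrac (f q) (f x) (f y) n.
Proof.
rewrite /cfrac /cfrac_from.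
have qintE h : f (qint q h) = qint (f q) h.
  by rewrite rmorph_sum; apply: eq_bigr => k _; rewrite rmorphXn.
have qint1E z h : f (qint1 q z h) = qint1 (f q) (f z) h.
  by rewrite rmorphD -/(qint q h.-1) qintE rmorphM rmorphXn.
have qint2E h : f (qint2 q x y h) = qint2 (f q) (f x) (f y) h.
  rewrite !rmorphD -/(qint q (h - 2)) qintE !rmorphM rmorphB rmorphD.
  by rewrite !rmorphXn !rmorphM.
suff convE d h m :
    f (convergent q x y d h m) = convergent (f q) (f x) (f y) d h m.
  exact: convE.
elim: d h m => [|d IHd] h m; first exact: rmorph0.
rewrite /= rmorph_inv_1B; apply: eq_inv_1B => -[|[|k]] _ /=.
- exact: rmorph0.
- by rewrite rmorphD !qint1E.
- by rewrite !rmorphM qintE qint2E IHd.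
Qed.
End Morphism.

(** * Standard cycle forms as words *)

Section Standard.
Local Open Scope nat_scope.
Implicit Types (C : seq (seq nat)) (c w : seq nat) (a m u : nat).

(** The shape of a standard cycle form: each block starts with its minimum,
    and these minima decrease, starting below [m]. *)
Fixpoint standard m C : bool :=
  if C is c :: C' then
    if c is a :: l then [&& a < m, all (ltn a) l & standard a C'] else false
  else true.

Lemma head_standard m C : standard m C -> head 0 (flatten C) <= m.
Proof. by case: C => [|[|a l] C] //= /andP[/ltnW]. Qed.

Lemma lrmin_standard m C : standard m C -> lrmin m (flatten C) = size C.
Proof.
elim: C m => [|[|a l] C IHC] m //= /and3P[lt_am al stdC].
rewrite lt_am (minn_idPr (ltnW lt_am)) -(IHC a) //; congr (_ + _).
elim: l al => //= v l IHl /andP[lt_av al].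
by rewrite [v < a]ltnNge ltnW //= (minn_idPl (ltnW lt_av)) IHl.
Qed.

(** The parentheses can be restored: a block ends where the first letter
    smaller than its head appears. *)
Lemma flatten_standard_inj m m' C C' :
  standard m C -> standard m' C' -> flatten C = flatten C' -> C = C'.
Proof.
have cut a l D : all (ltn a) l -> standard a D ->
    find (predC (ltn a)) (l ++ flatten D) = size l.
  move=> al; rewrite find_cat has_predC al /=.
  case: D => [|[|b l'] D] //=; first by rewrite addn0.
  by case/andP=> lt_ba _; rewrite ltnNge ltnW //= addn0.
elim: C m m' C' => [|[|a l] C IHC] m m' [|[|a' l'] C'] //=.
case/and3P=> _ al stdC /and3P[_ al' stdC'] [eq_a eq_lC].
move: al' stdC'; rewrite -eq_a => al' stdC'.
have eq_l : size l = size l' by rewrite -(cut a l C) // eq_lC cut.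
move/eqP: eq_lC; rewrite eqseq_cat // => /andP[/eqP-> /eqP /(IHC a a)-> //].
Qed.

(** The hypothesis makes the junction of [c] and [w] a non-ascent. *)
Lemma straddles_cat u c w : all (leq (head 0 w)) c ->
  straddles u (c ++ w) = straddles u c + straddles u w.
Proof.
elim: c => [|v c IHc] //= /andP[le_wv cw]; rewrite IHc // addnA.
case: c cw {IHc} => [|v' c] //= _.
have -> : (v < u < head 0 w) = false by lia.
by rewrite ltn0 andbF.
Qed.

Lemma occ213_cat c w : all (leq (head 0 w)) c ->
  occ213 (c ++ w) = occ213 c + \sum_(u <- c) straddles u w + occ213 w.
Proof.
elim: c => [|v c IHc] /=; first by rewrite big_nil.
move=> /andP[_ cw]; rewrite big_cons IHc // straddles_cat //; lia.
Qed.

Lemma standard_head_le m c C :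
  standard m (c :: C) -> all (leq (head 0 (flatten C))) c.
Proof.
case: c => [|a l] //= /and3P[_ al /head_standard le_a]; rewrite le_a /=.
by apply: sub_all al => v /ltnW; apply: leq_trans.
Qed.

Lemma standard_behead m c C : standard m (c :: C) -> standard (head 0 c) C.
Proof. by case: c => [|a l] //= /and3P[]. Qed.

Lemma straddles_flatten m u C :
  standard m C -> straddles u (flatten C) = \sum_(c <- C) straddles u c.
Proof.
elim: C m => [|c C IHC] m stdC; first by rewrite big_nil.
rewrite big_cons -(IHC _ (standard_behead stdC)) /= straddles_cat //.
exact: standard_head_le stdC.
Qed.

Lemma straddlesE u c : straddles u c =
  \sum_(t < (size c).-1) (nth 0 c t < u < nth 0 c t.+1).
Proof.
elim: c => [|v [|v' c] IHc]; first by rewrite big_ord0.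
  by rewrite big_ord0 /= ltn0 andbF.
by rewrite [LHS]/= -/(straddles u (v' :: c)) IHc big_ord_recl.
Qed.

Lemma occ213E c : occ213 c =
  \sum_(t < (size c).-1) \sum_(p < t) (nth 0 c t < nth 0 c p < nth 0 c t.+1).
Proof.
elim: c => [|u [|v c] IHc]; rewrite ?big_ord0 //.
rewrite -[LHS]/(straddles u (v :: c) + occ213 (v :: c)) IHc straddlesE.
rewrite -big_split.
rewrite big_ord_recl big_ord0 add0n; apply: eq_bigr => t _.
by rewrite big_ord_recl.
Qed.

Lemma occ_withinE C : occ_within C = \sum_(c <- C) occ213 c.
Proof.
by rewrite (big_nth [::]) big_mkord; apply: eq_bigr => a _; rewrite occ213E.
Qed.

Lemma occ_between_cons c C : occ_between (c :: C) =
  \sum_(u <- c) \sum_(c' <- C) straddles u c' + occ_between C.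
Proof.
rewrite /occ_between big_ord_recl big_ord0 add0n exchange_big.
rewrite [in RHS](big_nth [::]) big_mkord -big_split; apply: eq_bigr => b _.
rewrite big_ord_recl; congr (_ + _).
rewrite (big_nth 0) big_mkord; apply: eq_bigr => p _; by rewrite straddlesE.
Qed.

Lemma occ_standard m C :
  standard m C -> occ213 (flatten C) = occ_between C + occ_within C.
Proof.
rewrite occ_withinE.
elim: C m => [|c C IHC] m stdC; first by rewrite /occ_between big_ord0 big_nil.
have stdC' := standard_behead stdC.
rewrite /= occ213_cat ?(standard_head_le stdC) // (IHC _ stdC').
rewrite occ_between_cons big_cons.
under eq_bigr => u _ do rewrite (straddles_flatten _ stdC').
lia.
Qed.
End Standard.

Section CycleForm.
Local Open Scope nat_scope.
Variable N : nat.
Implicit Types (s : {perm 'I_N}) (c d : 'I_N).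

Definition foata_word s : seq nat := flatten (cycle_form s).

Lemma mem_cycle_minima s c :
  (c \in cycle_minima s) = [forall d in porbit s c, c <= d].
Proof. by rewrite mem_filter mem_rev mem_enum andbT. Qed.

Lemma standard_cycle_form s : standard N (cycle_form s).
Proof.
have desc : path gtn N [seq val c | c <- cycle_minima s].
  rewrite path_sortedE; last by move=> ? ? ? /[swap]; apply: ltn_trans.
  rewrite all_map; apply/andP; split; first by apply/allP=> c _; apply: ltn_ord.
  rewrite sorted_map; apply: sorted_filter.
    by move=> ? ? ? /[swap]; apply: ltn_trans.
  rewrite rev_sorted; have := iota_ltn_sorted 0 N.
  by rewrite -val_enum_ord sorted_map.
suff block cs m : path gtn m [seq val c | c <- cs] ->
    {subset cs <= cycle_minima s} ->
    standard m [seq [seq val d | d <- traject s c #|porbit s c|] | c <- cs].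
  exact: block.
elim: cs m => //= c cs IHcs m.
case/andP=> lt_cm cs_desc sub.
have := porbit_traject s c; have := uniq_traject_porbit s c.
have: c \in cycle_minima s by apply: sub; rewrite inE eqxx.
rewrite mem_cycle_minima => /forall_inP min_c.
case: #|_| (card_porbit_neq0 s c) => //= n _ /andP[c_notin _] mem_c.
rewrite lt_cm IHcs // ?andbT; last first.
  by move=> d d_cs; apply: sub; rewrite inE d_cs orbT.
rewrite andTb; apply/allP=> _ /mapP[d d_c ->] /=.
rewrite ltn_neqAle min_c ?mem_c ?inE ?d_c ?orbT // andbT.
by apply: contraNneq c_notin => /ord_inj E; rewrite {1}E.
Qed.

Lemma minimum_porbit s d : exists2 c, c \in cycle_minima s & d \in porbit s c.
Proof.
case: (arg_minnP (@nat_of_ord N) (porbit_id s d)) => c cd min_c.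
exists c; last by rewrite -eq_porbit_mem eq_porbit_mem porbit_sym.
rewrite mem_cycle_minima; apply/forall_inP=> e ec; apply: min_c.
by rewrite -(eqP (_ : porbit s c == porbit s d)) // eq_porbit_mem.
Qed.

Lemma porbit_minima_inj s : {in cycle_minima s &, injective (porbit s)}.
Proof.
move=> c d; rewrite !mem_cycle_minima => /forall_inP minc /forall_inP mind E.
apply/val_inj/eqP; rewrite eqn_leq minc ?mind //.
- by rewrite -E porbit_id.
- by rewrite E porbit_id.
Qed.

Lemma uniq_cycle_minima s : uniq (cycle_minima s).
Proof. by rewrite filter_uniq // rev_uniq enum_uniq. Qed.

Lemma porbits_minima s :
  perm_eq [seq porbit s c | c <- cycle_minima s] (enum (porbits s)).
Proof.
apply: uniq_perm (enum_uniq _) _.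
  rewrite map_inj_in_uniq ?uniq_cycle_minima //; exact: porbit_minima_inj.
move=> B; rewrite mem_enum.
apply/mapP/imsetP=> [[c _ ->]|[d _ ->]]; first by exists c.
have [c cs dc] := minimum_porbit s d.
by exists c => //; apply/eqP; rewrite eq_porbit_mem.
Qed.

Lemma size_cycle_form s : size (cycle_form s) = #|porbits s|.
Proof.
rewrite size_map -(size_map (porbit s)) (perm_size (porbits_minima s)).
by rewrite cardE.
Qed.

Lemma perm_foata_word s : foata_word s \in permutations (iota 0 N).
Proof.
rewrite mem_permutations.
pose L := flatten [seq traject s c #|porbit s c| | c <- cycle_minima s].
have -> : foata_word s = [seq val d | d <- L].
  by rewrite /foata_word /L map_flatten -map_comp.
rewrite -val_enum_ord perm_map //.
apply: uniq_perm (enum_uniq _) _.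
  apply: uniq_flatten_map (uniq_cycle_minima s) _ _
    => [c _|c c' c_min c'_min d].
    exact: uniq_traject_porbit.
  rewrite -!porbit_traject -!eq_porbit_mem => /eqP-> /eqP.
  exact: porbit_minima_inj.
move=> d; rewrite mem_enum; have [c c_min d_c] := minimum_porbit s d.
apply/flattenP; exists (traject s c #|porbit s c|); first exact: map_f.
by rewrite -porbit_traject.
Qed.

(** The word determines the cycles as lists, hence the trajectories of [s]
    from the cycle minima; the last entry of a cycle is sent back to its
    minimum. *)
Lemma foata_word_inj : injective foata_word.
Proof.
move=> s s' eq_w; apply/permP=> d.
have E := flatten_standard_inj (standard_cycle_form s)
  (standard_cycle_form s') eq_w.
have [c cs dc] := minimum_porbit s d.
have : [seq val e | e <- traject s c #|porbit s c|] \in cycle_form s.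
  exact: map_f.
rewrite E => /mapP[c' c's' /(inj_map val_inj)].
move: (card_porbit_neq0 s c) (card_porbit_neq0 s' c') dc.
move: (iter_porbit s c) (iter_porbit s' c'); rewrite porbit_traject.
case: #|_| => // n s_c; case: #|_| => // n' s'_c' _ _.
case/trajectP=> i lt_in -> eq_t.
have eq_n : n' = n by have := congr1 size eq_t; rewrite !size_traject => -[].
have eq_c : c' = c by case: eq_t.
move: eq_n eq_c eq_t s'_c' => -> -> eq_t s'_c.
have eq_iter j : j <= n.+1 -> iter j s c = iter j s' c.
  rewrite leq_eqVlt => /predU1P[->|lt_jn]; first by rewrite s_c.
  by rewrite -!(@nth_traject _ _ _ n.+1) // eq_t.
by rewrite [in RHS]eq_iter 1?ltnW // -!iterS eq_iter.
Qed.

Lemma perm_foata_words :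
  perm_eq [seq foata_word s | s <- enum {perm 'I_N}] (permutations (iota 0 N)).
Proof.
have uniq_words : uniq [seq foata_word s | s <- enum {perm 'I_N}].
  by rewrite map_inj_uniq ?enum_uniq //; apply: foata_word_inj.
apply: uniq_perm => //; first exact: permutations_uniq.
apply: (uniq_min_size uniq_words _ _).2.
  by move=> _ /mapP[s _ ->]; apply: perm_foata_word.
rewrite size_permutations ?iota_uniq // size_iota size_map -cardE.
by rewrite (card_Sn N).
Qed.

Lemma cyclic_occE s : cyclic_occ s = occ213 (foata_word s).
Proof. by rewrite (occ_standard (standard_cycle_form s)). Qed.

Lemma card_porbitsE s : #|porbits s| = lrmin N (foata_word s).
Proof. by rewrite lrmin_standard ?standard_cycle_form // size_cycle_form. Qed.

End CycleForm.

(** * The generating function of permutations *)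

Theorem theorem1 (i j n : nat) : (Phi i j n)%:Z = (F n).[1]`_j`_i.
Proof.
have -> : (F n).[1] = cfrac ('X%:P : {poly {poly int}}) 'X 1 n.
  rewrite -[LHS]/(horner_eval 1 (F n)) rmorph_cfrac /=.
  by rewrite !horner_evalE hornerX !hornerC.
set C := cfrac _ _ _ n; have -> : C`_j = ('X * C)`_j.+1 by rewrite coefXM.
rewrite -completions_cfrac -sum_permutations -(perm_big _ (perm_foata_words _)).
rewrite big_map big_enum !coef_sum /Phi -sum1_card -natz natr_sum big_mkcond /=.
apply: eq_bigr => s _; rewrite inE cyclic_occE card_porbitsE.
rewrite -polyC_exp coefCM coefXn.
rewrite [j.+1 == _]eq_sym andbC; case: eqP => _; last by rewrite mulr0 coef0.
by rewrite mulr1 coefXn eq_sym; case: eqP.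
Qed.
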